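(* Let $1\le k\le\lfloor n/2\rfloor$ and let $G_{k\times n}=[\mathbb{1}_k\,|\,A]$, with $A=(a_{i,j})\in GF(q)^{k\times(n-k)}$, be a generator matrix in standard form of an MDS code $[n,k,n-k+1]_q$. Let $\overline{A}$ be the matrix formed by the first $k-1$ rows of $A$, let $G_{\widehat{k}}=[\mathbb{1}_{k-1}\,|\,\overline{A}]$ with entries $\overline g_{i,j}$ (a $(k-1)\times(n-1)$ matrix), and let $\overline{H}=[-\overline{A}^{T}\,|\,\mathbb{1}_{n-k}]$ with entries $\overline h_{l,j}$ be its $(n-k)\times(n-1)$ parity check matrix. Let $|\psi_0\rangle=\sum_{\vec v\in GF(q)^{k-1}}|\vec v\,G_{\widehat{k}}\rangle$, let $\vec m_X=(0,\dots,0,a_{k,1},\dots,a_{k,n-k})$ (with $k-1$ leading zeros) be the vector of exponents of the Pauli string $$M=\underbrace{\mathbb{1}\otimes\cdots\otimes\mathbb{1}}_{k-1}\otimes X^{a_{k,1}}\otimes\cdots\otimes X^{a_{k,n-k}},$$ and let $\mathcal{C}=\operatorname{span}\{M^m|\psi_0\rangle : 0\le m\le q-1\}\subset(\mathbb{C}^q)^{\otimes(n-1)}$. Then $\mathcal{C}$ is a stabilizer code, and the generators of its stabilizer group are the $X$-type operators $$\bigotimes_{j=1}^{n-1}X^{\overline g_{i,j}},\qquad 1\le i\le k-1,$$ together with the $Z$-type operators $$\bigotimes_{j=1}^{n-1}Z^{\sum_{l=1}^{n-k}v_l\,\overline h_{l,j}},\qquad \vec v\in GF(q)^{n-k}\ \text{with}\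 \vec m_X\cdot(\vec v\,\overline H)=0 .$$ The number of generators that involve $X$ operators is $k-1$ and the number of those that involve $Z$ operators is $n-k-1$, in total $n-2$ generators.
   Context: **Classical codes.** A linear code $[n,k,d_H]_q$ is a $k$-dimensional subspace of $GF(q)^n$ with minimum Hamming distance $d_H$; it is MDS if $d_H=n-k+1$. **Pauli operators.** $X|j\rangle=|j+1 \bmod q\rangle$ and $Z|j\rangle=\omega^j|j\rangle$ with $\omega=e^{2\pi i/q}$, where $|j\rangle$ are the computational basis states of $\mathbb{C}^q$. A Pauli string is a tensor product of powers of these operators; the exponents above are elements of $GF(q)$ (for $q$ prime, integers mod $q$), and $M^m$ is the $m$-th power of $M$. For a vector $w$ over $GF(q)$, $|w\rangle=|w_1\rangle\otimes|w_2\rangle\otimes\cdots$. States are understood up to normalization. **Stabilizer codes.** A stabilizer group $S$ is an abelian group of Pauli strings not containing $-\mathbb{1}$. The stabilizer code defined by $S$ is the subspace of all vectors $|\psi\rangle$ with $S_i|\psi\rangle=|\psi\rangle$ for every $S_i\in S$. The number of generators refers to independent generators.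
   Formalization: q is assumed prime: for a proper prime power the powers X^a with a in GF(q) are not defined, or M has order p < q, so the span of the M^m|ψ_0⟩ is not the code of the listed operators (e.g. q=4, n=3, k=1, A=[1 1]). *)

(* Defs.v *)
(* The complex numbers are R[i] for a realType R; GF(q) is 'F_q, which has q
   elements only for q prime. *)
From HB Require Import structures.
From mathcomp Require Import all_boot all_order all_algebra.
From mathcomp Require Import complex.
From mathcomp Require Import boolp classical_sets reals topology normedtype.
From mathcomp Require Import sequences trigo.

Set Implicit Arguments.
Unset Strict Implicit.
Unset Printing Implicit Defensive.

Import Order.TTheory GRing.Theory Num.Theory.

Local Open Scope classical_set_scope.
Local Open Scope ring_scope.
Local Open Scope complex_scope.

Section ClassicalCodes.
Variable F : finFieldType.

Definition hamming_dist (m : nat) (x y : 'rV[F]_m) : nat :=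
  #|[set j : 'I_m | x 0 j != y 0 j]%SET|.

Definition has_min_dist (m : nat) (U : {vspace 'rV[F]_m}) (d : nat) : Prop :=
  (exists x y, [/\ x \in U, y \in U, x != y & hamming_dist x y = d]) /\
  (forall x y, x \in U -> y \in U -> x != y -> (d <= hamming_dist x y)%N).

Definition linear_code (m : nat) (U : {vspace 'rV[F]_m}) (n k d : nat) : Prop :=
  [/\ m = n, \dim U = k & has_min_dist U d].

Definition code_generated_by (k m : nat) (G : 'M[F]_(k, m)) :
    {vspace 'rV[F]_m} :=
  <<[seq row i G | i : 'I_k]>>%VS.

Definition standard_generator (k r : nat) (A : 'M[F]_(k, r)) :
    'M[F]_(k, k + r) :=
  row_mx 1%:M A.

Definition standard_parity_check (k r : nat) (A : 'M[F]_(k, r)) :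
    'M[F]_(r, k + r) :=
  row_mx (- A^T) 1%:M.

Definition all_rows_but_last (k r : nat) (A : 'M[F]_(k, r)) :
    'M[F]_(k.-1, r) :=
  rowsub (widen_ord (leq_pred k)) A.

Definition last_index (k : nat) (hk : (0 < k)%N) : 'I_k :=
  Ordinal (etrans (ltn_predL k) hk).

Definition last_row (k r : nat) (hk : (0 < k)%N) (A : 'M[F]_(k, r)) : 'rV[F]_r :=
  row (last_index hk) A.

Definition dot (m : nat) (x y : 'rV[F]_m) : F := \sum_j x 0 j * y 0 j.

End ClassicalCodes.

(* For a finite type T of labels, C^T is 'cV[C]_#|T|, the coordinate of label t
   being the one of index [enum_rank t].  One qudit has T := 'F_q, and N qudits
   have T := 'rV['F_q]_N. *)
Section Qudits.
Variables (R : realType) (q : nat).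
Local Notation C := R[i].

Notation qudit := 'cV[C]_#|'F_q|.
Notation qudit_op := 'M[C]_#|'F_q|.
Notation state N := 'cV[C]_#|{: 'rV['F_q]_N}|.
Notation op N := 'M[C]_#|{: 'rV['F_q]_N}|.

Definition omega : C :=
  (cos (2 * pi / q%:R) : R) +i* (sin (2 * pi / q%:R) : R).

Definition basis_state (j : 'F_q) : qudit := delta_mx (enum_rank j) 0.

(* Entry (i, j) is the coefficient of |i> in the image of |j>. *)
Definition X : qudit_op :=
  \matrix_(i, j) ((enum_val i : 'F_q) == enum_val j + 1)%:R.

Definition Z : qudit_op :=
  \matrix_(i, j) (omega ^+ (enum_val j : 'F_q) *+ (i == j)).

Definition tensor_state (N : nat) (v : 'I_N -> qudit) : state N :=
  \col_u \prod_(j < N) v j (enum_rank ((enum_val u : 'rV['F_q]_N) 0 j)) 0.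

Definition tensor_op (N : nat) (M : 'I_N -> qudit_op) : op N :=
  \matrix_(u, w) \prod_(j < N)
    M j (enum_rank ((enum_val u : 'rV['F_q]_N) 0 j))
        (enum_rank ((enum_val w : 'rV['F_q]_N) 0 j)).

Definition ket (N : nat) (w : 'rV['F_q]_N) : state N :=
  tensor_state (fun j => basis_state (w 0 j)).

Definition Xstring (N : nat) (x : 'rV['F_q]_N) : op N :=
  tensor_op (fun j => X ^+ (x 0 j : 'F_q)).

Definition Zstring (N : nat) (z : 'rV['F_q]_N) : op N :=
  tensor_op (fun j => Z ^+ (z 0 j : 'F_q)).

(* The phases are those produced by reordering products of X and Z. *)
Definition pauli_string (N : nat) : set (op N) :=
  [set P | exists (c : nat) (x z : 'rV['F_q]_N),
     P = omega ^+ c *: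
         tensor_op (fun j => X ^+ (x 0 j : 'F_q) *m Z ^+ (z 0 j : 'F_q))].

Definition operator_group (N : nat) (S : set (op N)) : Prop :=
  [/\ S 1%:M,
      forall P Q, S P -> S Q -> S (P *m Q),
      forall P, S P -> P \in unitmx &
      forall P, S P -> S (invmx P)].

Definition generated_group (N : nat) (L : set (op N)) : set (op N) :=
  smallest (@operator_group N) L.

Definition stabilizer_group (N : nat) (S : set (op N)) : Prop :=
  [/\ operator_group S,
      S `<=` @pauli_string N,
      forall P Q, S P -> S Q -> P *m Q = Q *m P &
      ~ S (- 1%:M)].

Definition stabilizer_code (N : nat) (S : set (op N)) : set (state N) :=
  [set psi | forall P, S P -> P *m psi = psi].

Definition pauli_stabilizer (N : nat) (U : {vspace state N}) : set (op N) :=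
  [set P | pauli_string P /\ forall psi, psi \in U -> P *m psi = psi].

(* [rem P s] deletes one occurrence of P, so an independent list is free of
   repetitions. *)
Definition independent (N : nat) (s : seq (op N)) : Prop :=
  forall P, P \in s -> ~ generated_group [set` rem P s] P.

Definition independent_generators_from (N : nat) (L s : seq (op N)) : Prop :=
  [/\ {subset s <= L},
      independent s &
      generated_group [set` s] = generated_group [set` L]].

Section Construction.
Variables (k r : nat) (hk : (0 < k)%N) (A : 'M['F_q]_(k, r)).

Definition G_hat : 'M['F_q]_(k.-1, k.-1 + r) :=
  standard_generator (all_rows_but_last A).

Definition H_bar : 'M['F_q]_(r, k.-1 + r) :=
  standard_parity_check (all_rows_but_last A).

Definition m_X : 'rV['F_q]_(k.-1 + r) := row_mx 0 (last_row hk A).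

Definition psi0 : state (k.-1 + r) :=
  \sum_(v : 'rV['F_q]_(k.-1)) ket (v *m G_hat).

Definition spanned_code : {vspace state (k.-1 + r)} :=
  <<[seq Xstring m_X ^+ m *m psi0 | m <- iota 0 q]>>%VS.

Definition X_generators : seq (op (k.-1 + r)) :=
  [seq Xstring (row i G_hat) | i : 'I_k.-1].

Definition Z_generators : seq (op (k.-1 + r)) :=
  [seq Zstring (v *m H_bar) |
     v <- enum {: 'rV['F_q]_r} & dot m_X (v *m H_bar) == 0].

End Construction.
End Qudits.

(* Main.v *)
From HB Require Import structures.
Require Import Defs.
From mathcomp Require Import all_boot all_order all_algebra.
From mathcomp Require Import zify complex.
From mathcomp Require Import boolp classical_sets reals trigo.

(** Write [pauli (x, z)] for the string X^x Z^z.  On the span T of the exponents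
    of the generators the symplectic pairing vanishes, so [pauli] is an injective
    group morphism there: the generated group is [pauli @` T], and independent
    generating lists are the bases of T contained in the list of exponents.  T is
    the direct sum of the row space of G and of the words of the dual code
    orthogonal to m_X, of dimensions k - 1 and n - k - 1.

    A state fixed by [pauli @` T] is constant on the cosets of the row space of G
    (X-type) and supported on the words orthogonal to the Z-exponents (Z-type),
    i.e. on the row space of G extended by m_X.  These are the combinations of
    the q coset states M^c psi0, which have disjoint supports because the last
    row of A is nonzero. *)

Import Order.TTheory GRing.Theory Num.Theory.
Local Open Scope classical_set_scope.
Local Open Scope ring_scope.
Set Implicit Arguments.
Unset Strict Implicit.
Unset Printing Implicit Defensive.

(** * The additive character of GF(q) defined by [omega] *)

Section Character.
Variables (R : realType) (q : nat).
Hypothesis q_prime : prime q.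
Local Notation omega := (omega R q).

Lemma omega_exp m : omega ^+ m =
  (cos (2 * pi / q%:R *+ m) +i* sin (2 * pi / q%:R *+ m))%C.
Proof.
rewrite /omega; set t := 2 * pi / q%:R.
elim: m => [|m IHm]; first by rewrite expr0 mulr0n cos0 sin0.
rewrite exprSr IHm mulrSr cosD sinD.
by apply/eqP; rewrite eq_complex /= eqxx [X in X == _]addrC eqxx.
Qed.

Lemma omega_expq : omega ^+ q = 1.
Proof.
rewrite omega_exp -[_ *+ q]mulr_natr mulfVK ?pnatr_eq0 -?lt0n ?prime_gt0 //.
by rewrite -[2]/(1 + 1 : R) mulrDl mul1r -mulr2n cos2pi sin2pi.
Qed.

(** As q is at least 2, the angle 2 pi / q lies in (0, pi], where the cosine is injective and so
    differs from cos 0. *)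
Lemma omega_neq1 : omega != 1.
Proof.
have q0 : 0 < q%:R :> R by rewrite ltr0n prime_gt0.
have pi0 := pi_gt0 R.
have le_pi : 2 * pi / q%:R <= pi :> R.
  by rewrite ler_pdivrMr // mulrC ler_pM2l // ler_nat prime_gt1.
have gt0 : 0 < 2 * pi / q%:R :> R by rewrite divr_gt0 // mulr_gt0.
apply/eqP => /eqP; rewrite /omega; set t := 2 * pi / q%:R in le_pi gt0 *.
rewrite eq_complex /= => /andP[/eqP + _]; rewrite -cos0 => /cos_inj.
rewrite !in_itv /= lexx !pi_ge0 le_pi (ltW gt0) => /(_ isT isT) /eqP.
by rewrite gt_eqF.
Qed.

Definition chi (a : 'F_q) : R[i] := omega ^+ a.

Lemma chi_nat m : chi m%:R = omega ^+ m.
Proof. by rewrite /chi val_Fp_nat // expr_mod // omega_expq. Qed.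

Lemma chi0 : chi 0 = 1.
Proof. by []. Qed.

Lemma chiD a b : chi (a + b) = chi a * chi b.
Proof. by rewrite -[a]natr_Zp -[b]natr_Zp -natrD !chi_nat exprD. Qed.

Lemma chiM a b : chi (a * b) = chi a ^+ b.
Proof. by rewrite -[a]natr_Zp -[b]natr_Zp -natrM !chi_nat exprM natr_Zp. Qed.

Lemma chi_sum (I : finType) (f : I -> 'F_q) :
  chi (\sum_i f i) = \prod_i chi (f i).
Proof. exact: (big_morph chi chiD chi0). Qed.

Lemma chi_neq0 a : chi a != 0.
Proof.
apply/eqP => a0; have := chiD a (- a).
by rewrite subrr a0 mul0r chi0 => /eqP; rewrite oner_eq0.
Qed.

(** If a is invertible and chi a = 1, then chi 1 = chi (a * a^-1) is a power of chi a, hence 1,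
    although it equals [omega]. *)
Lemma chi_eq1 a : (chi a == 1) = (a == 0).
Proof.
apply/eqP/eqP => [a1|->//]; apply/eqP; apply: contraT => a0.
have : chi 1 = omega by rewrite -[1]/(1%:R) chi_nat expr1.
by rewrite -(divff a0) chiM a1 expr1n => /esym/eqP; rewrite (negPf omega_neq1).
Qed.

Lemma chi_inj : injective chi.
Proof.
move=> a b ab; apply/eqP; rewrite -subr_eq0 -chi_eq1 chiD ab -chiD subrr.
by rewrite chi0.
Qed.
End Character.

(** * Bilinearity of the dot product *)

Section Dot.
Variables (F : finFieldType) (N : nat).
Local Notation vec := 'rV[F]_N.

Lemma dotC (x y : vec) : dot x y = dot y x.
Proof. by apply: eq_bigr => j _; rewrite mulrC. Qed.

Lemma dotDl (x y z : vec) : dot (x + y) z = dot x z + dot y z.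
Proof. by rewrite -big_split; apply: eq_bigr => j _; rewrite mxE mulrDl. Qed.

Lemma dotDr (x y z : vec) : dot x (y + z) = dot x y + dot x z.
Proof. by rewrite !(dotC x) dotDl. Qed.

Lemma dotZl c (x y : vec) : dot (c *: x) y = c * dot x y.
Proof. by rewrite mulr_sumr; apply: eq_bigr => j _; rewrite mxE mulrA. Qed.

Lemma dotZr c (x y : vec) : dot x (c *: y) = c * dot x y.
Proof. by rewrite dotC dotZl dotC. Qed.

Lemma dot0l (y : vec) : dot 0 y = 0.
Proof. by rewrite -(scale0r 0) dotZl mul0r. Qed.

Lemma dot0r (y : vec) : dot y 0 = 0.
Proof. by rewrite dotC dot0l. Qed.

Lemma dot_delta (x : vec) j : dot (delta_mx 0 j) x = x 0 j.
Proof.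
rewrite /dot (bigD1 j) //= big1 ?addr0 => [|i /negPf ij]; rewrite mxE eqxx /=.
  by rewrite eqxx mul1r.
by rewrite ij mul0r.
Qed.

End Dot.

(** * Pauli strings without phase and their products *)

Section Pauli.
Variables (R : realType) (q : nat).
Hypothesis q_prime : prime q.
Variable N : nat.
Local Notation chi := (chi R).
Local Notation vec := 'rV['F_q]_N.
Local Notation op := 'M[R[i]]_#|{: vec}|.

Lemma X_exp m : X R q ^+ m =
  \matrix_(i, j) ((enum_val i : 'F_q) == enum_val j + m%:R)%:R.
Proof.
elim: m => [|m IHm]; apply/matrixP => i j.
  by rewrite !mxE addr0 (inj_eq enum_val_inj).
rewrite exprS IHm !mxE (bigD1 (enum_rank (enum_val j + m%:R : 'F_q))) //=.
rewrite big1 ?addr0 => [|l]; rewrite !mxE ?enum_rankK.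
  by rewrite eqxx mulr1 mulrSr addrA.
rewrite -(inj_eq enum_val_inj) enum_rankK => /negPf->; exact: mulr0.
Qed.

Lemma Z_exp m : Z R q ^+ m =
  \matrix_(i, j) ((chi (enum_val j)) ^+ m *+ (i == j)).
Proof.
elim: m => [|m IHm]; apply/matrixP => i j; first by rewrite !mxE expr0.
rewrite exprS IHm !mxE (bigD1 j) //=.
rewrite big1 ?addr0 => [|l /negPf lj]; rewrite !mxE.
  by rewrite eqxx exprS mulrnAl.
by rewrite lj mulr0n mulr0.
Qed.

(** Giving the entries directly, with the Z-part acting first, lets products be computed without
    tensor products; [tensor_op_pauli] makes the link. *)
Definition pauli (a : vec * vec) : op :=
  \matrix_(u, w) (((enum_val u : vec) == enum_val w + a.1)%:R *
    chi (dot (enum_val w) a.2)).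

Lemma tensor_op_pauli (a : vec * vec) :
  tensor_op (fun j => X R q ^+ (a.1 0 j) *m Z R q ^+ (a.2 0 j)) = pauli a.
Proof.
apply/matrixP => u w; rewrite !mxE chi_sum //.
have -> : (enum_val u == enum_val w + a.1)%:R =
    \prod_j ((enum_val u) 0 j == (enum_val w + a.1) 0 j)%:R :> R[i].
  have [->|ne] := eqVneq (enum_val u) (enum_val w + a.1).
    by rewrite big1 // => j _; rewrite eqxx.
  have /existsP[j /negPf ne_j] :
      [exists j, (enum_val u) 0 j != (enum_val w + a.1) 0 j].
    apply: contraR ne; rewrite negb_exists => /forallP eq_uw.
    by apply/eqP/rowP => j; apply/eqP/negPn.
  by rewrite (bigD1 j) //= ne_j mul0r.
rewrite -big_split; apply: eq_bigr => j _ /=.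
rewrite X_exp Z_exp !mxE (bigD1 (enum_rank ((enum_val w : vec) 0 j))) //=.
rewrite big1 ?addr0 => [|l /negPf lj]; rewrite !mxE ?enum_rankK.
  by rewrite eqxx natr_Zp chiM.
by rewrite lj mulr0n mulr0.
Qed.

Lemma pauli_enum_rank (a : vec * vec) u w :
  pauli a (enum_rank u) (enum_rank w) = (u == w + a.1)%:R * chi (dot w a.2).
Proof. by rewrite mxE !enum_rankK. Qed.

(** Row u of [pauli a] has a single nonzero entry, in column u - a.1. The width p is free so that
    this serves both for products of strings and for the action on states. *)
Lemma mul_pauli (a : vec * vec) p (M : 'M_(_, p)) u j :
  (pauli a *m M) (enum_rank u) j =
  chi (dot (u - a.1) a.2) * M (enum_rank (u - a.1)) j.
Proof.
rewrite mxE (bigD1 (enum_rank (u - a.1))) //= pauli_enum_rank subrK eqxx mul1r.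
rewrite big1 ?addr0 // => w.
rewrite -(inj_eq enum_val_inj) enum_rankK eq_sym => ne.
by rewrite mxE enum_rankK -subr_eq (negPf ne) !mul0r.
Qed.

(** The phase comes from moving the Z-part of a past the X-part of b. *)
Lemma pauliM a b : pauli a *m pauli b = chi (dot b.1 a.2) *: pauli (a + b).
Proof.
apply/matrixP => u' w'; rewrite -[u']enum_valK -[w']enum_valK [RHS]mxE.
set u := enum_val u'; set w := enum_val w'.
rewrite mul_pauli !pauli_enum_rank subr_eq addrAC -addrA.
have [->|] := eqVneq; last by rewrite !mul0r !mulr0.
rewrite !mul1r /= addrA addrAC addrK dotDl dotDr !chiD //.
by rewrite mulrCA mulrA.
Qed.

Lemma pauli0 : pauli 0 = 1%:M.
Proof.
apply/matrixP => u w.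
by rewrite !mxE addr0 dot0r chi0 mulr1 (inj_eq enum_val_inj).
Qed.

(** Column 0 is supported at a.1 only, which recovers the X-part. The nonzero entry in the column of
    the j-th unit vector is then chi of the j-th coordinate of the Z-part, and chi is injective. *)
Lemma pauli_inj : injective pauli.
Proof.
move=> a b ab.
have eq1 : a.1 = b.1.
  have := pauli_enum_rank a a.1 0; rewrite ab pauli_enum_rank.
  rewrite !add0r !dot0l eqxx mulr1.
  by case: eqVneq => // _ /eqP; rewrite mulr1 eq_sym oner_eq0.
rewrite [a]surjective_pairing [b]surjective_pairing eq1; congr pair.
apply/rowP => j; rewrite -!dot_delta; apply: (@chi_inj R q q_prime).
have := pauli_enum_rank a (delta_mx 0 j + a.1) (delta_mx 0 j).
by rewrite ab pauli_enum_rank eq1 eqxx !mul1r.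
Qed.

(** The entry at (a.1, 0) is 1 on the left, but 0 or -1 on the right. *)
Lemma pauli_neqN1 a : pauli a <> - 1%:M.
Proof.
have /eqP N0 : 2%:R != 0 :> R[i] by rewrite pnatr_eq0.
move/matrixP/(_ (enum_rank a.1) (enum_rank 0)).
rewrite pauli_enum_rank add0r eqxx dot0l mulr1 !mxE => /eqP.
case: (enum_rank a.1 =P _) => _; last by rewrite mulr0n oppr0 oner_eq0.
by rewrite -addr_eq0 -mulr2n => /eqP/N0.
Qed.

Lemma Xstring_pauli x : Xstring R x = pauli (x, 0).
Proof.
rewrite -tensor_op_pauli; apply/matrixP => u w; rewrite [LHS]mxE [RHS]mxE.
apply: eq_bigr => j _ /=. by rewrite [(0 : vec) 0 j]mxE expr0 mulmx1.
Qed.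

Lemma Zstring_pauli z : Zstring R z = pauli (0, z).
Proof.
rewrite -tensor_op_pauli; apply/matrixP => u w; rewrite [LHS]mxE [RHS]mxE.
apply: eq_bigr => j _ /=. by rewrite [(0 : vec) 0 j]mxE expr0 mul1mx.
Qed.

Lemma Xstring_exp (x : vec) m : Xstring R x ^+ m = Xstring R (x *+ m).
Proof.
elim: m => [|m IHm].
  by rewrite expr0 mulr0n Xstring_pauli (_ : (0, 0) = 0) ?pauli0.
rewrite exprS IHm !Xstring_pauli.
have -> : forall P Q : op, P * Q = P *m Q by [].
by rewrite pauliM dot0r scale1r mulrS; congr (pauli (_, _)); rewrite addr0.
Qed.

Lemma pauli_stringP P :
  pauli_string P <-> exists c a, P = omega R q ^+ c *: pauli a.
Proof.
split=> [[c [x [z ->]]]|[c [a ->]]].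
  by exists c, (x, z); rewrite -tensor_op_pauli.
by exists c, a.1, a.2; rewrite -tensor_op_pauli.
Qed.

Lemma ket_entry (w u : vec) : ket R w (enum_rank u) 0 = (u == w)%:R.
Proof.
rewrite mxE; have [->|ne] := eqVneq u w.
  by rewrite big1 // => j _; rewrite enum_rankK mxE !eqxx.
have /existsP[j /negPf ne_j] : [exists j, u 0 j != w 0 j].
  apply: contraR ne; rewrite negb_exists => /forallP eq_uw.
  by apply/eqP/rowP => j; apply/eqP/negPn.
by rewrite (bigD1 j) //= enum_rankK mxE (inj_eq enum_rank_inj) ne_j mul0r.
Qed.

End Pauli.

(** This is freeness in the form of [independent], where each element is compared with what the
    others generate. *)
Lemma free_remP (K : fieldType) (vT : vectType K) (t : seq vT) :
  free t <-> forall a, a \in t -> a \notin <<rem a t>>%VS.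
Proof.
split=> [free_t a /perm_to_rem/perm_free|].
  by rewrite free_t free_cons => /esym/andP[].
elim: t => [|b t IHt] rem_t; first by rewrite nil_free.
have b_t : b \notin <<t>>%VS.
  by have := rem_t b (mem_head b t); rewrite /= eqxx.
rewrite free_cons b_t; apply: IHt => a a_t.
have := rem_t a (mem_behead (s := b :: t) a_t); rewrite /=.
case: eqVneq => [eq_ba|_].
  by rewrite -eq_ba in a_t; rewrite memv_span in b_t.
by apply/contra/subvP/sub_span => x; rewrite inE orbC => ->.
Qed.

(** The members of t that belong to u form a free list inside the span of u. *)
Lemma count_free (K : fieldType) (vT : vectType K) (t u : seq vT) :
  free t -> (count [in u] t <= \dim <<u>>)%N.
Proof.
move=> free_t; rewrite -size_filter.
rewrite -(eqP (filter_free [in u] free_t)) dimvS //.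
by apply: sub_span => x; rewrite mem_filter => /andP[].
Qed.

(** * Pauli groups attached to isotropic subspaces *)

Section PauliGroup.
Variables (R : realType) (q : nat).
Hypothesis q_prime : prime q.
Variable N : nat.
Local Notation V := ('rV['F_q]_N * 'rV['F_q]_N)%type.
Local Notation pauli := (@pauli R q N).

(** Both terms of the symplectic form vanish separately. This is stronger than commutation: it also
    removes the phase in [pauliM], so [pauli] turns sums into products on T. *)
Definition isotropic (T : {vspace V}) :=
  {in T &, forall a b, dot a.1 b.2 = 0}.

Lemma isotropicS (T T' : {vspace V}) :
  (T <= T')%VS -> isotropic T' -> isotropic T.
Proof. by move=> /subvP sTT' isoT' a b /sTT' aT' /sTT'; apply: isoT'. Qed.

Lemma pauli_isotropicM T a b : isotropic T -> a \in T -> b \in T ->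
  pauli a *m pauli b = pauli (a + b).
Proof. by move=> isoT aT bT; rewrite pauliM // isoT // chi0 scale1r. Qed.

Lemma operator_group_pauli T : isotropic T ->
  operator_group [set pauli a | a in [set` T]].
Proof.
move=> isoT.
have mulV a : a \in T -> pauli a *m pauli (- a) = 1%:M.
  by move=> aT; rewrite (pauli_isotropicM isoT) ?memvN // subrr pauli0.
split=> [|_ _ [a /= aT <-] [b /= bT <-]|_ [a /= aT <-]|_ [a /= aT <-]].
- by exists 0; rewrite /= ?mem0v ?pauli0.
- by exists (a + b); rewrite /= ?memvD // (pauli_isotropicM isoT).
- by have [] := mulmx1_unit (mulV a aT).
- exists (- a); first by rewrite /= memvN.
  have [a_unit _] := mulmx1_unit (mulV a aT).
  by rewrite -[RHS]mulmx1 -(mulV a aT) mulKmx.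
Qed.

Lemma generated_group_pauli (t : seq V) : isotropic <<t>>%VS ->
  generated_group [set` map pauli t] = [set pauli a | a in [set` <<t>>%VS]].
Proof.
move=> isoT; apply/seteqP; split.
  apply: smallest_sub; first exact: operator_group_pauli.
  by move=> _ /mapP[a a_t ->]; exists a => //; apply: memv_span.
move=> _ [a /= a_t <-] H [[H1 HM _ _] sH].
rewrite (coord_span (X := in_tuple t) a_t).
(* Membership in the span is carried through the induction because the phase-free product rule
   requires it. *)
suff [] : (\sum_i coord (in_tuple t) i a *: (in_tuple t)`_i \in <<t>>%VS) /\
  H (pauli (\sum_i coord (in_tuple t) i a *: (in_tuple t)`_i)) by [].
apply: (big_ind (fun b => b \in <<t>>%VS /\ H (pauli b))).
- by rewrite mem0v pauli0.
- move=> b c [bT Hb] [cT Hc]; rewrite memvD // -(pauli_isotropicM isoT) //.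
  by split=> //; exact: (HM _ _ Hb Hc).
move=> i _; set b := _`_i; move: (coord _ i a) => c.
have b_t : b \in t by apply: mem_nth.
have bT := memv_span b_t.
(* A scalar of the prime field is a natural number, so scaling an exponent is taking a power of the
   operator. *)
rewrite memvZ //; split=> //; rewrite -[c]natr_Zp scaler_nat.
elim: (c : nat) => [|m IHm]; first by rewrite pauli0.
rewrite mulrS -(pauli_isotropicM isoT) ?rpredMn //; apply: (HM _ _ _ IHm).
by apply: sH; apply: map_f.
Qed.

(** Injectivity of [pauli] makes it commute with [rem], and generated groups become spans, so the
    claim reduces to [free_remP]. *)
Lemma independent_pauli (t : seq V) : isotropic <<t>>%VS ->
  independent (map pauli t) <-> free t.
Proof.
move=> isoT; rewrite free_remP.
have gen_rem a : generated_group [set` rem (pauli a) (map pauli t)] (pauli a)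
    <-> a \in <<rem a t>>%VS.
  have -> : rem (pauli a) (map pauli t) = map pauli (rem a t).
    elim: (t) => //= b u ->; rewrite (inj_eq (@pauli_inj R q q_prime N)).
    by case: (b == a).
  rewrite generated_group_pauli; last first.
    by apply: isotropicS isoT; apply: sub_span => x /mem_rem.
  by split=> [[b /= + /(pauli_inj q_prime) ba]|a_t]; [rewrite ba | exists a].
split=> [ind a a_t|free_t _ /mapP[a a_t ->] /gen_rem].
  by apply/negP => /gen_rem; apply: ind; apply: map_f.
exact/negP/free_t.
Qed.

Lemma stabilizer_group_pauli T : isotropic T ->
  stabilizer_group [set pauli a | a in [set` T]].
Proof.
move=> isoT; split; first exact: operator_group_pauli.
- move=> _ [a _ <-]; apply/pauli_stringP => //.
  by exists 0%N, a; rewrite expr0 scale1r.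
- move=> _ _ [a /= aT <-] [b /= bT <-].
  by rewrite !(pauli_isotropicM isoT) // addrC.
- by move=> [a _ /(pauli_neqN1)].
Qed.

Section Generators.
Variables tX tZ : seq V.
Hypothesis iso : isotropic <<tX ++ tZ>>%VS.
Local Notation L := (map pauli tX ++ map pauli tZ).

Lemma independent_generators_pauli s : independent_generators_from L s <->
  exists t, [/\ s = map pauli t, {subset t <= tX ++ tZ},
                free t & <<t>>%VS = <<tX ++ tZ>>%VS].
Proof.
rewrite /independent_generators_from -map_cat generated_group_pauli //.
split=> [[sL ind gen]|[t [-> t_sub free_t gen]]].
  have [t def_s t_sub] : exists2 t, s = map pauli t & {subset t <= tX ++ tZ}.
    elim: s {ind gen} sL => [|P s IHs] sL; first by exists [::].
    have [x xs|t -> t_sub] := IHs; first by apply: sL; rewrite inE xs orbT.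
    have /mapP[a aL ->] := sL P (mem_head _ _).
    by exists (a :: t) => // x; rewrite inE => /predU1P[->|/t_sub].
  subst s.
  have isot : isotropic <<t>>%VS by apply: isotropicS iso; apply: sub_span.
  exists t; split=> //; first exact/independent_pauli.
  move: gen; rewrite generated_group_pauli // => /seteqP[sub1 sub2].
  apply/eqP; rewrite eqEsubv; apply/andP; split; apply/subvP => a aT.
  - have [|b /= bT /(pauli_inj q_prime) <-] := sub1 (pauli a) => //.
    by exists a.
  - have [|b /= bT /(pauli_inj q_prime) <-] := sub2 (pauli a) => //.
    by exists a.
have isot : isotropic <<t>>%VS by rewrite gen.
split; last by rewrite generated_group_pauli // gen.
  by move=> _ /mapP[a /t_sub aL ->]; apply: map_f.
exact/independent_pauli.
Qed.

Lemma ex_independent_generators : exists s, independent_generators_from L s.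
Proof.
suff [t [t_sub free_t gen]] : exists t, [/\ {subset t <= tX ++ tZ}, free t &
    <<t>>%VS = <<tX ++ tZ>>%VS].
  by exists (map pauli t); apply/independent_generators_pauli; exists t.
(* Greedy extraction of a basis: a is kept only if it lies outside the span of the vectors already
   kept. *)
elim: (tX ++ tZ) => [|a u [t [t_sub free_t gen]]].
  by exists [::]; rewrite nil_free.
have [a_t|a_t] := boolP (a \in <<t>>%VS).
  exists t; rewrite span_cons -gen; split=> // [x /t_sub|].
    by rewrite inE orbC => ->.
  by apply/esym/addv_idPr; rewrite -memvE.
exists (a :: t); rewrite free_cons a_t free_t !span_cons gen; split=> // x.
by rewrite !inE => /predU1P[->|/t_sub ->]; rewrite ?eqxx ?orbT.
Qed.

(** A basis has as many elements as the two dimensions together. By [count_free] each list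
    contributes at most its own dimension, and every element comes from one of the lists, so both
    bounds are attained. *)
Lemma count_independent_generators s :
  \dim <<tX ++ tZ>>%VS = (\dim <<tX>>%VS + \dim <<tZ>>%VS)%N ->
  independent_generators_from L s ->
  [/\ count [in map pauli tX] s = \dim <<tX>>%VS,
      count [in map pauli tZ] s = \dim <<tZ>>%VS &
      size s = (\dim <<tX>>%VS + \dim <<tZ>>%VS)%N].
Proof.
move=> dimD /independent_generators_pauli[t [-> t_sub free_t gen]].
have size_t : size t = (\dim <<tX>> + \dim <<tZ>>)%N.
  by rewrite -dimD -gen (eqP free_t).
have cX := count_free tX free_t; have cZ := count_free tZ free_t.
have cXZ : (size t <= count [in tX] t + count [in tZ] t)%N.
  rewrite -count_predUI (leq_trans _ (leq_addr _ _)) // eq_leq //.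
  apply/esym/eqP; rewrite -all_count; apply/allP => x /t_sub.
  by rewrite mem_cat.
have count_pauli u : count [in map pauli u] (map pauli t) = count [in u] t.
  rewrite count_map; apply: eq_count => x /=.
  by rewrite mem_map //; apply: pauli_inj.
rewrite !count_pauli size_map size_t; split=> //; apply/eqP; rewrite eqn_leq.
  rewrite cX -(leq_add2r (\dim <<tZ>>)) -size_t (leq_trans cXZ) //.
  by rewrite leq_add2l.
rewrite cZ -(leq_add2l (\dim <<tX>>)) -size_t (leq_trans cXZ) //.
by rewrite leq_add2r.
Qed.

End Generators.
End PauliGroup.

(** Turning plain functions into elements of 'Hom gives access to their kernels, images and
    rank-nullity. *)
Lemma ex_linfun (K : fieldType) (aT rT : vectType K) (f : aT -> rT) :
  linear f -> exists F : 'Hom(aT, rT), F =1 f.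
Proof.
move=> lin_f; pose fmix := GRing.isLinear.Build _ _ _ _ f lin_f.
pose fL : {linear aT -> rT} := HB.pack f fmix.
by exists (linfun fL) => x; exact: (lfunE fL).
Qed.

(** * Generator and parity check matrices in standard form *)

Section ParityCheck.
Variables (F : finFieldType) (p r : nat) (B : 'M[F]_(p, r)).
Local Notation G := (standard_generator B).
Local Notation H := (standard_parity_check B).

Lemma dotE n (x y : 'rV[F]_n) : dot x y = (x *m y^T) 0 0.
Proof. by rewrite mxE; apply: eq_bigr => j _; rewrite mxE. Qed.

Lemma dot_row_mx n1 n2 (x1 y1 : 'rV[F]_n1) (x2 y2 : 'rV[F]_n2) :
  dot (row_mx x1 x2) (row_mx y1 y2) = dot x1 y1 + dot x2 y2.
Proof. by rewrite !dotE tr_row_mx mul_row_col mxE. Qed.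

Lemma mulmx_generator (v : 'rV_p) : v *m G = row_mx v (v *m B).
Proof. by rewrite mul_mx_row mulmx1. Qed.

Lemma mulmx_parity_check (w : 'rV_r) : w *m H = row_mx (- (w *m B^T)) w.
Proof. by rewrite mul_mx_row mulmx1 mulmxN. Qed.

(** The vector u2 - u1 B is the syndrome of (u1 | u2). *)
Lemma dot_parity_check u1 u2 (w : 'rV_r) :
  dot (row_mx u1 u2) (w *m H) = dot (u2 - u1 *m B) w.
Proof.
rewrite mulmx_parity_check dot_row_mx !dotE linearN /= trmx_mul trmxK.
by rewrite mulmxN mulmxBl mulmxA !mxE addrC.
Qed.

Lemma dot_generator_parity_check (v : 'rV_p) (w : 'rV_r) :
  dot (v *m G) (w *m H) = 0.
Proof. by rewrite mulmx_generator dot_parity_check subrr dotE mul0mx mxE. Qed.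

(** The identity block of H forces w to be the right half of z; testing against the rows of G then
    determines the left half. *)
Lemma generator_orthogonal z : (forall v : 'rV_p, dot (v *m G) z = 0) ->
  exists w : 'rV_r, z = w *m H.
Proof.
move=> z0; exists (rsubmx z); rewrite mulmx_parity_check -{1}[z]hsubmxK.
congr row_mx; apply/rowP => i; apply/eqP; rewrite [X in _ == X]mxE -addr_eq0.
have := z0 (delta_mx 0 i); rewrite mulmx_generator -{1}[z]hsubmxK dot_row_mx.
by rewrite dot_delta dotC dotE trmx_mul mulmxA -dotE dotC dot_delta => ->.
Qed.

(** With a_j nonzero, the vectors e_i - (a_i / a_j) e_j are orthogonal to a; orthogonality of b to
    them gives b_i = (b_j / a_j) a_i. *)
Lemma colinear_orthogonal (a b : 'rV[F]_r) : a != 0 ->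
  (forall w, dot a w = 0 -> dot b w = 0) -> exists c, b = c *: a.
Proof.
move=> /rV0Pn[j aj] ab; exists (b 0 j / a 0 j); apply/rowP => i; rewrite mxE.
have dot_diff (x : 'rV[F]_r) :
    dot x (delta_mx 0 i - (a 0 i / a 0 j) *: delta_mx 0 j) =
    x 0 i - (a 0 i / a 0 j) * x 0 j.
  by rewrite dotC -scaleNr dotDl dotZl !dot_delta mulNr.
have /ab : dot a (delta_mx 0 i - (a 0 i / a 0 j) *: delta_mx 0 j) = 0.
  by rewrite dot_diff mulfVK // subrr.
by rewrite dot_diff => /eqP; rewrite subr_eq0 => /eqP->; rewrite mulrC mulrA mulrAC.
Qed.

Variable a : 'rV[F]_r.
Hypothesis a_neq0 : a != 0.
Local Notation m := (row_mx 0 a : 'rV_(p + r)).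

Lemma dot_last_parity_check (w : 'rV_r) : dot m (w *m H) = dot a w.
Proof. by rewrite dot_parity_check mul0mx subr0. Qed.

(** The syndrome of u is orthogonal to everything orthogonal to a, so it is a multiple of a, which
    is the syndrome of m. *)
Lemma parity_check_orthogonal u :
  (forall w : 'rV_r, dot m (w *m H) = 0 -> dot u (w *m H) = 0) ->
  exists (v : 'rV_p) c, u = v *m G + c *: m.
Proof.
rewrite -[u]hsubmxK => u0.
have [w|c def_c] := @colinear_orthogonal a (rsubmx u - lsubmx u *m B) a_neq0.
  by rewrite -dot_last_parity_check -dot_parity_check; apply: u0.
exists (lsubmx u), c; rewrite mulmx_generator scale_row_mx add_row_mx -def_c.
by rewrite scaler0 addr0 addrC subrK.
Qed.

Lemma coset_inj (v : 'rV_p) c (v' : 'rV_p) c' :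
  v *m G + c *: m = v' *m G + c' *: m -> v = v' /\ c = c'.
Proof.
rewrite !mulmx_generator !scale_row_mx !add_row_mx !scaler0 !addr0.
move=> /eq_row_mx[<- /addrI/eqP]; rewrite -subr_eq0 -scalerBl scaler_eq0.
by rewrite (negPf a_neq0) orbF subr_eq0 => /eqP.
Qed.

End ParityCheck.

(** * The code spanned by the coset states, and its stabilizer *)

Section CosetCode.
Variables (R : realType) (q : nat).
Hypothesis q_prime : prime q.
Variables (p r : nat) (B : 'M['F_q]_(p, r)) (a : 'rV['F_q]_r).
Hypothesis a_neq0 : a != 0.
Local Notation G := (standard_generator B).
Local Notation H := (standard_parity_check B).
Local Notation m := (row_mx 0 a : 'rV_(p + r)).
Local Notation V := ('rV['F_q]_(p + r) * 'rV['F_q]_(p + r))%type.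
Local Notation pauli := (@pauli R q (p + r)).
Local Notation state := 'cV[R[i]]_#|{: 'rV['F_q]_(p + r)}|.

Definition X_exponents : seq V := [seq (row i G, 0) | i : 'I_p].

Definition Z_exponents : seq V :=
  [seq (0, w *m H) | w <- enum {: 'rV['F_q]_r} & dot m (w *m H) == 0].

Local Notation tX := X_exponents.
Local Notation tZ := Z_exponents.

Lemma span_X_exponents : exists f : 'Hom('rV['F_q]_p, V),
  [/\ forall v, f v = (v *m G, 0), lker f = 0%VS & <<tX>>%VS = limg f].
Proof.
have [|f fE] := @ex_linfun _ 'rV['F_q]_p V (fun v => (v *m G, 0)).
  move=> c u v; congr pair; first by rewrite mulmxDl -scalemxAl.
  by rewrite /= scaler0 addr0.
exists f; split=> //.
  apply/eqP/lker0P => u v; rewrite !fE => -[].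
  by rewrite !mulmx_generator => /eq_row_mx[].
apply/eqP; rewrite eqEsubv; apply/andP; split.
  apply/span_subvP => _ /mapP[i _ ->]; rewrite rowE -fE.
  exact: memv_img (memvf _).
apply/subvP => _ /memv_imgP[v _ ->]; rewrite [v]row_sum_delta linear_sum /=.
apply: memv_suml => i _; rewrite linearZ /= memvZ // fE -rowE memv_span //.
by apply/mapP; exists i => //; rewrite mem_enum.
Qed.

(** The orthogonality condition is presented as the kernel of g, with its value wrapped in a 1 x 1
    matrix, in preparation for rank-nullity. *)
Lemma span_Z_exponents : exists f : 'Hom('rV['F_q]_r, V),
  [/\ forall w, f w = (0, w *m H), lker f = 0%VS &
      exists2 g : 'Hom('rV['F_q]_r, 'M['F_q]_1),
        (forall w, g w = (dot m (w *m H))%:M) & <<tZ>>%VS = (f @: lker g)%VS].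
Proof.
have [|f fE] := @ex_linfun _ 'rV['F_q]_r V (fun w => (0, w *m H)).
  move=> c u v; congr pair; last by rewrite mulmxDl -scalemxAl.
  by rewrite /= scaler0 addr0.
have [|g gE] := @ex_linfun _ 'rV['F_q]_r 'M['F_q]_1
    (fun w => (dot m (w *m H))%:M).
  move=> c u v; rewrite mulmxDl -scalemxAl dotDr dotZr raddfD /=.
  by rewrite scale_scalar_mx.
exists f; split=> //.
  apply/eqP/lker0P => u v; rewrite !fE => -[].
  by rewrite !mulmx_parity_check => /eq_row_mx[].
exists g => //; apply/eqP; rewrite eqEsubv; apply/andP; split.
  apply/span_subvP => _ /mapP[w + ->]; rewrite mem_filter => /andP[/eqP w0 _].
  by rewrite -fE memv_img // memv_ker gE w0 raddf0.
apply/subvP => _ /memv_imgP[w + ->]; rewrite memv_ker gE => /eqP/matrixP.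
move=> /(_ 0 0); rewrite !mxE mulr1n => w0; rewrite fE memv_span //.
by apply/mapP; exists w => //; rewrite mem_filter w0 eqxx mem_enum.
Qed.

Lemma dim_X_exponents : \dim <<tX>>%VS = p.
Proof.
have [f [_ f0 ->]] := span_X_exponents.
by rewrite limg_dim_eq ?f0 ?capv0 // dimvf /dim /= mul1n.
Qed.

Lemma dim_Z_exponents : \dim <<tZ>>%VS = r.-1.
Proof.
have [f [_ f0 [g gE ->]]] := span_Z_exponents.
rewrite limg_dim_eq ?f0 ?capv0 //.
suff limg_full : limg g = fullv.
  have := limg_ker_dim g fullv; rewrite capfv limg_full !dimvf !dim_matrix.
  by move: (\dim (lker g)) => d; rewrite !(mulr1, mul1r) addn1 => <-.
apply/eqP; rewrite eqEsubv subvf; apply/subvP => x _.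
have /rV0Pn[j aj] := a_neq0.
(* Since g is w -> a . w, a unit vector at a nonzero coordinate of a, rescaled, reaches any value.
   Hence g has rank 1 and its kernel dimension r - 1. *)
apply/memv_imgP; exists ((x 0 0 / a 0 j) *: delta_mx 0 j); first exact: memvf.
rewrite gE dot_last_parity_check dotZr dotC dot_delta divfK //.
exact: mx11_scalar.
Qed.

Lemma mem_span_exponents b : b \in <<tX ++ tZ>>%VS <->
  (exists v : 'rV_p, b.1 = v *m G) /\
  (exists2 w : 'rV_r, b.2 = w *m H & dot m b.2 = 0).
Proof.
have [f [fE _ spanX]] := span_X_exponents.
have [h [hE _ [g gE spanZ]]] := span_Z_exponents.
rewrite span_cat spanX spanZ; split.
  case/memv_addP => _ /memv_imgP[v _ ->] [_ /memv_imgP[w wg ->] ->].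
  rewrite fE hE /= add0r addr0; split; first by exists v.
  exists w => //; move: wg; rewrite memv_ker gE => /eqP/matrixP/(_ 0 0).
  by rewrite !mxE mulr1n.
case=> -[v b1] [w b2 mb2]; apply/memv_addP; exists (f v).
  exact: memv_img (memvf _).
exists (h w); first by rewrite memv_img // memv_ker gE -b2 mb2 raddf0.
by rewrite fE hE [b]surjective_pairing b1 b2; congr pair; rewrite ?addr0 ?add0r.
Qed.

Lemma dim_exponents :
  \dim <<tX ++ tZ>>%VS = (\dim <<tX>>%VS + \dim <<tZ>>%VS)%N.
Proof.
have [f [fE _ spanX]] := span_X_exponents.
have [h [hE _ [g gE spanZ]]] := span_Z_exponents.
rewrite span_cat dimv_disjoint_sum //; apply/eqP; rewrite -subv0.
apply/subvP => b; rewrite spanX spanZ memv_cap memv0.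
by case/andP => /memv_imgP[v _ ->] /memv_imgP[w _]; rewrite fE hE => -[-> _].
Qed.

Lemma isotropic_exponents : isotropic <<tX ++ tZ>>%VS.
Proof.
move=> b c /mem_span_exponents[[v ->] _] /mem_span_exponents[_ [w -> _]].
exact: dot_generator_parity_check.
Qed.

Definition coset_state (c : 'F_q) : state :=
  \sum_(v : 'rV['F_q]_p) ket R (v *m G + c *: m).

(** Distinct v give distinct words, so no basis state occurs twice in the sum. *)
Lemma coset_state_entry c u : coset_state c (enum_rank u) 0 =
  [exists v, u == v *m G + c *: m]%:R.
Proof.
rewrite summxE; case: existsP => [[v /eqP->]|no_v].
  rewrite (bigD1 v) //= ket_entry eqxx big1 ?addr0 // => w /eqP wv.
  by rewrite ket_entry; case: eqP => // /(coset_inj a_neq0)[/esym].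
rewrite big1 // => v _; rewrite ket_entry; case: eqP => // uv.
by case: no_v; exists v; apply/eqP.
Qed.

Lemma Xstring_coset_state i :
  Xstring R m ^+ i *m coset_state 0 = coset_state i%:R.
Proof.
apply/colP => u'; rewrite -[u']enum_valK; set u := enum_val u'.
rewrite Xstring_exp // Xstring_pauli // mul_pauli // dot0r chi0 mul1r.
rewrite !coset_state_entry; congr (nat_of_bool _)%:R.
by apply: eq_existsb => v; rewrite /= scale0r addr0 subr_eq scaler_nat.
Qed.

Local Notation U :=
  (<<[seq Xstring R m ^+ i *m coset_state 0%R | i <- iota 0 q]>>%VS :
     {vspace state}).

Lemma coset_state_in_code c : coset_state c \in U.
Proof.
apply: memv_span; apply/mapP; exists (c : nat).
  by rewrite mem_iota /= add0n -{2}(Fp_cast q_prime) ltn_ord.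
by rewrite Xstring_coset_state natr_Zp.
Qed.

(** The X-part permutes the words of the coset, and the Z-part is orthogonal to all of them, so its
    phase is 1. *)
Lemma pauli_coset_state b c : b \in <<tX ++ tZ>>%VS ->
  pauli b *m coset_state c = coset_state c.
Proof.
case/mem_span_exponents => -[v b1] [w b2 mb2].
apply/colP => u'; rewrite -[u']enum_valK; set u := enum_val u'.
rewrite mul_pauli // !coset_state_entry b1.
have -> : [exists x, u - v *m G == x *m G + c *: m] =
          [exists x, u == x *m G + c *: m].
  apply/existsP/existsP => -[x /eqP ux].
    by exists (x + v); rewrite mulmxDl addrAC -ux subrK.
  by exists (x - v); rewrite mulmxBl ux addrAC.
case: existsP => [[x /eqP ux]|_]; last by rewrite mulr0.
rewrite ux addrAC -mulmxBl dotDl dotZl mb2 mulr0 addr0 b2.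
by rewrite dot_generator_parity_check chi0 mulr1.
Qed.

Lemma mem_coset_code (psi : state) : psi \in U <->
  forall b, b \in <<tX ++ tZ>>%VS -> pauli b *m psi = psi.
Proof.
split=> [psiU b bT|fix_psi].
  rewrite (coord_span (X := in_tuple _) psiU) mulmx_sumr; apply: eq_bigr => i _.
  rewrite -scalemxAr; congr (_ *: _).
  have /mapP[j _ ->] := mem_nth 0 (ltn_ord i).
  by rewrite Xstring_coset_state pauli_coset_state.
(* The coefficient of each coset state is read off at the representative c m. *)
suff -> : psi = \sum_c psi (enum_rank (c *: m)) 0 *: coset_state c.
  by apply: memv_suml => c _; rewrite memvZ // coset_state_in_code.
apply/colP => u'; rewrite -[u']enum_valK; set u := enum_val u'.
rewrite summxE.
have [/existsP[v /existsP[c /eqP def_u]]|no_vc] :=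
  boolP [exists v : 'rV_p, exists c, u == v *m G + c *: m].
  rewrite (bigD1 c) //= big1 ?addr0 => [|d dc]; rewrite mxE coset_state_entry.
    have -> : [exists v, u == v *m G + c *: m].
      by apply/existsP; exists v; rewrite def_u.
    (* Invariance under the X-string of v G carries the entry at u to the one at c m. *)
    rewrite mulr1 -{1}(fix_psi (v *m G, 0)) ?mul_pauli //=.
      by rewrite dot0r chi0 mul1r def_u addrC addKr.
    apply/mem_span_exponents; split; first by exists v.
    by exists 0; rewrite ?mul0mx //= dot0r.
  case: existsP => [[x /eqP]|]; last by rewrite mulr0.
  by rewrite def_u => /(coset_inj a_neq0)[_ dc']; rewrite dc' eqxx in dc.
rewrite big1 => [|c _]; last first.
  rewrite mxE coset_state_entry.
  case: existsP => [[v uv]|]; last by rewrite mulr0.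
  by case/existsP: no_vc; exists v; apply/existsP; exists c.
(* If the entry at u is nonzero, each Z-string must act on it with phase 1, so u is orthogonal to
   all Z-exponents and lies in one of the cosets. *)
apply/eqP; apply: contraR no_vc => psi_u.
have [|v [c def_u]] := @parity_check_orthogonal _ _ _ B _ a_neq0 u.
  move=> w mw; apply/eqP; rewrite -(chi_eq1 R q_prime).
  have wT : (0, w *m H) \in <<tX ++ tZ>>%VS.
    by apply/mem_span_exponents; split; [exists 0; rewrite mul0mx | exists w].
  have := mul_pauli (0, w *m H) psi u 0.
  rewrite (fix_psi _ wT) /= subr0 -{1}[psi _ _]mul1r => /(mulIf psi_u) <-.
  by [].
by apply/existsP; exists v; apply/existsP; exists c; rewrite def_u.
Qed.

Lemma coset_code_stabilizer P :
  pauli_stabilizer U P <-> exists2 b, b \in <<tX ++ tZ>>%VS & pauli b = P.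
Proof.
split=> [[/(pauli_stringP q_prime)[e [b ->]] fixP]|[b bT <-]]; last first.
  split; first by apply/pauli_stringP => //; exists 0%N, b; rewrite expr0 scale1r.
  by move=> psi /mem_coset_code; apply.
have fix_entry c u : omega R q ^+ e * (chi R (dot (u - b.1) b.2) *
    coset_state c (enum_rank (u - b.1)) 0) = coset_state c (enum_rank u) 0.
  have := fixP _ (coset_state_in_code c).
  by move/colP/(_ (enum_rank u)); rewrite -scalemxAl mxE mul_pauli.
have in_coset v c : coset_state c (enum_rank (v *m G + c *: m)) 0 = 1.
  rewrite coset_state_entry; case: existsP => // -[].
  by exists v.
have coset00 : coset_state 0 (enum_rank 0) 0 = 1.
  by have := in_coset 0 0; rewrite mul0mx scale0r addr0.
(* The entry of the state with c = 0 at b.1 equals the phase, which is nonzero; so b.1 lies in the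
   row space of G, the entry is 1, and so is the phase. *)
have [[v b1] e1] : (exists v : 'rV_p, b.1 = v *m G) /\ omega R q ^+ e = 1.
  have := fix_entry 0 b.1; rewrite subrr dot0l chi0 coset00 !mulr1.
  rewrite coset_state_entry; case: existsP => [[v /eqP b1] ->|_ /eqP].
    by split=> //; exists v; rewrite b1 scale0r addr0.
  by rewrite -chi_nat // (negPf (chi_neq0 R q_prime _)).
exists b; last by rewrite e1 scale1r.
(* Below, c = 0 puts b.2 in the dual code, and x = 0, c = 1 makes it orthogonal to m. *)
have dot_b2 x c : dot (x *m G + c *: m) b.2 = 0.
  have := fix_entry c (x *m G + c *: m + b.1).
  rewrite addrK in_coset e1 mul1r mulr1 b1 addrAC -mulmxDl in_coset => /eqP.
  by rewrite chi_eq1 // => /eqP.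
apply/mem_span_exponents; split; first by exists v.
have [|w b2] := @generator_orthogonal _ _ _ B b.2.
  by move=> x; have := dot_b2 x 0; rewrite scale0r addr0.
by exists w; last by have := dot_b2 0 1; rewrite mul0mx add0r scale1r.
Qed.

End CosetCode.

(** If the last row of A were zero, the last row of the generator matrix would be a unit vector, a
    nonzero codeword of weight 1. *)
Lemma MDS_last_row_neq0 (F : finFieldType) (n k r d : nat) (hk : (0 < k)%N)
    (A : 'M[F]_(k, r)) :
  linear_code (code_generated_by (standard_generator A)) n k d ->
  (1 < d)%N -> last_row hk A != 0.
Proof.
case=> _ _ [_ dist] d_gt1; apply: contraL d_gt1 => /eqP a0.
set i := last_index hk; set x := row i (standard_generator A).
have def_x : x = row_mx (delta_mx 0 i) 0.
  by rewrite /x /standard_generator row_row_mx row1 -a0.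
have x_neq0 : x != 0.
  apply/eqP => /rowP/(_ (lshift r i)).
  by rewrite def_x row_mxEl !mxE !eqxx => /eqP; rewrite oner_eq0.
rewrite -leqNgt (leq_trans (dist x 0 _ _ x_neq0)) ?mem0v //.
  by apply/memv_span/mapP; exists i; rewrite ?mem_enum.
apply: (@leq_trans #|[set lshift r i]%SET|); last by rewrite cards1.
rewrite /hamming_dist subset_leq_card //; apply/fintype.subsetP => j.
rewrite !inE def_x mxE.
case: split_ordP => j' ->; rewrite !mxE ?eqxx //=.
rewrite (inj_eq (@lshift_inj _ _)). by case: (j' == i); rewrite /= ?eqxx.
Qed.

(** * Translation of the construction into exponents, and the theorem *)

Section Construction.
Variables (R : realType) (q : nat).
Hypothesis q_prime : prime q.
Variables (k r : nat) (hk : (0 < k)%N) (A : 'M['F_q]_(k, r)).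
Local Notation B := (all_rows_but_last A).
Local Notation a := (last_row hk A).

Lemma X_generatorsE : X_generators R A = map (@pauli R q _) (X_exponents B).
Proof. by rewrite -map_comp; apply: eq_map => i; apply: Xstring_pauli. Qed.

Lemma Z_generatorsE :
  Z_generators R hk A = map (@pauli R q _) (Z_exponents B a).
Proof. by rewrite -map_comp; apply: eq_map => w; apply: Zstring_pauli. Qed.

Lemma psi0E : psi0 R A = coset_state R B a 0.
Proof. by apply: eq_bigr => v _; rewrite scale0r addr0. Qed.

End Construction.

Theorem mainTheorem4 (R : realType) (q : nat) (hq : prime q)
    (n k : nat) (hk : (1 <= k)%N) (hkn : (k <= n %/ 2)%N)
    (A : 'M['F_q]_(k, n - k))
    (hMDS : linear_code (code_generated_by (standard_generator A))
              n k (n - k + 1)) :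
  let L := X_generators R A ++ Z_generators R hk A in
  let S := generated_group [set` L] in
  let U := spanned_code R hk A in
  [/\ stabilizer_group S,
      [set psi | psi \in U] = stabilizer_code S,
      S = pauli_stabilizer U,
      (exists s, independent_generators_from L s) &
      forall s, independent_generators_from L s ->
        [/\ count [in X_generators R A] s = (k - 1)%N,
            count [in Z_generators R hk A] s = (n - k - 1)%N &
            size s = (n - 2)%N]].
Proof.
have lt_kn : (k < n)%N by lia.
have a_neq0 : last_row hk A != 0.
  by apply: (MDS_last_row_neq0 _ hMDS); rewrite addn1 ltnS subn_gt0.
move=> L S U; set B := all_rows_but_last A.
set tX := X_exponents B; set tZ := Z_exponents B (last_row hk A).
have iso : isotropic <<tX ++ tZ>>%VS by apply: isotropic_exponents.
have LE : L = map (@pauli R q _) tX ++ map (@pauli R q _) tZ.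
  by rewrite /L (X_generatorsE R hq) (Z_generatorsE R hq).
have SE : S = [set pauli R b | b in [set` <<tX ++ tZ>>%VS]].
  by rewrite /S LE -map_cat generated_group_pauli.
split.
- by rewrite SE; apply: stabilizer_group_pauli.
- apply/seteqP; split=> psi; rewrite /U /spanned_code (psi0E _ hk).
    move=> /(mem_coset_code hq B a_neq0 psi) fix_psi P.
    by rewrite SE => -[b /= /fix_psi + <-].
  move=> fix_psi; apply/(mem_coset_code hq B a_neq0 psi) => b bT.
  by apply: fix_psi; rewrite SE; exists b.
- apply/seteqP; rewrite SE /U /spanned_code (psi0E _ hk); split=> P.
    by case=> b /= bT <-; apply/(coset_code_stabilizer hq B a_neq0); exists b.
  by move=> /(coset_code_stabilizer hq B a_neq0 P).
- by rewrite LE; apply: ex_independent_generators.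
move=> s; rewrite LE => ind_s.
have [] := count_independent_generators hq iso (dim_exponents _ _) ind_s.
rewrite dim_X_exponents dim_Z_exponents //.
rewrite -(X_generatorsE R hq) -(Z_generatorsE R hq).
by move=> -> -> ->; split; lia.
Qed.
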